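(* Let $\alpha>0$, let $t(\mathbf{x})=\alpha \|\mathbf{x}\|^2$ for $\mathbf{x}\in\mathbb{R}^n$, and let $T:=\{(\mathbf{x},\alpha\|\mathbf{x}\|^2) : \mathbf{x}\in\mathbb{R}^n\}\subset\mathbb{R}^n\times\mathbb{R}$ be its graph. Let $(\overline{\mathbf{x}},\overline{y})\in(\mathbb{R}^n\times\mathbb{R})\setminus T$ and let $$\Delta := \frac{(1-2\alpha\overline{y})^3}{216\alpha^6}+\frac{\|\overline{\mathbf{x}}\|^2}{16\alpha^4}.$$ Then the projection of $(\overline{\mathbf{x}},\overline{y})$ onto $T$ is given by $$P_T(\overline{\mathbf{x}},\overline{y})=\begin{cases} (\mathbf{0},0) &\text{if }\overline{\mathbf{x}}=\mathbf{0}\text{ and } \Delta\geq 0,\\ \big\{(\mathbf{w},t(\mathbf{w})) : \mathbf{w}\in\mathbb{R}^n,\ \|\mathbf{w}\|=\sqrt{(1/\alpha)\overline{y}-1/(2\alpha^2)}\big\}&\text{if } \overline{\mathbf{x}}=\mathbf{0}\text{ and } \Delta< 0,\\ (\mathbf{w}_1,t(\mathbf{w}_1)) & \text{if }\overline{\mathbf{x}}\neq \mathbf{0}\text{ and }\Delta\geq 0,\\ (\mathbf{w}_2,t(\mathbf{w}_2)) &\text{if }\overline{\mathbf{x}}\neq \mathbf{0}\text{ and }\Delta<0, \end{cases}$$ where $\mathbf{w}_i:=(w_i/\|\overline{\mathbf{x}}\|)\,\overline{\mathbf{x}}$ for $i\in\{1,2\}$, with $$w_1:=\sqrt[3]{\frac{\|\overline{\mathbf{x}}\|}{4\alpha^2}-\sqrt{\Delta}}+\sqrt[3]{\frac{\|\overline{\mathbf{x}}\|}{4\alpha^2}+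 \sqrt{\Delta}},\qquad w_2:=2\sqrt{\frac{2\alpha\overline{y}-1}{6\alpha^2}}\,\cos(\vartheta/3),$$ and $\vartheta:=\arccos\left(\dfrac{\frac{3\sqrt{6}}{2}\,\alpha\|\overline{\mathbf{x}}\|}{(2\alpha\overline{y}-1)^{3/2}}\right)$.
   Context: $n\ge 1$ is an integer, and $\|\cdot\|$ is the Euclidean norm (on $\mathbb{R}^n$ and on $\mathbb{R}^n\times\mathbb{R}=\mathbb{R}^{n+1}$). For a set $T\subset\mathbb{R}^{n+1}$ and a point $z\in\mathbb{R}^{n+1}$, the projection $P_T(z)$ is the set of all points of $T$ at minimal Euclidean distance from $z$, i.e. all $u\in T$ with $\|u-z\|=\min_{v\in T}\|v-z\|$. When this set is a singleton it is identified with its unique element, so ''$P_T(z)=u$'' means that $u$ is the unique nearest point. Here $\sqrt[3]{\cdot}$ denotes the real cube root (defined on all of $\mathbb{R}$), and $\arccos$ takes values in $[0,\pi]$. The quantities $w_1$ and $w_2$ are only considered in the case in which they are used. *)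

(* Defs.v *)
From HB Require Import structures.
From mathcomp Require Import all_boot all_order all_algebra.
From mathcomp Require Import boolp classical_sets reals exp trigo.

Set Implicit Arguments.
Unset Strict Implicit.
Unset Printing Implicit Defensive.

Import Order.TTheory GRing.Theory Num.Theory.

Local Open Scope classical_set_scope.
Local Open Scope ring_scope.

(* The norm that MathComp-Analysis puts on 'rV_m is the sup norm, hence this
   separate definition. *)
Definition enorm (R : realType) (m : nat) (x : 'rV[R]_m) : R :=
  Num.sqrt (\sum_(i < m) x 0 i ^+ 2).

(* (x, y) as an element of R^n x R = R^(n+1) *)
Definition pt (R : realType) (n : nat) (x : 'rV[R]_n) (y : R) : 'rV[R]_(n + 1) :=
  row_mx x y%:M.

Definition proj (R : realType) (m : nat) (T : set 'rV[R]_m) (z : 'rV[R]_m)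
    : set 'rV[R]_m :=
  [set u | T u /\ forall v, T v -> enorm (u - z) <= enorm (v - z)].

(* powR is meaningful only for nonnegative bases, hence the sign; cbrtK shows
   that this is the real cube root on all of R. *)
Definition cbrt (R : realType) (x : R) : R := Num.sg x * (`|x| `^ 3^-1).

Lemma cbrtK (R : realType) (x : R) : cbrt x ^+ 3 = x.
Proof.
have root3 : (`|x| `^ 3^-1) ^+ 3 = `|x|.
  by rewrite -powR_mulrn ?powR_ge0// -powRrM mulVf ?pnatr_eq0// powRr1.
rewrite /cbrt exprMn root3 exprS; have [->|x0] := eqVneq x 0.
  by rewrite sgr0 !mul0r.
by rewrite sqr_sg x0 mulr1 -numEsg.
Qed.

(* Main.v *)
(* With [lambda := 2 alpha^2 |b|^2 + 1 - 2 alpha ybar] and [xbar = lambda b],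
   the squared distance from [(xbar, ybar)] to [(v, t v)] exceeds the one to
   [(b, t b)] by [alpha^2 (|v|^2 - |b|^2)^2 + lambda |v - b|^2].  So whenever
   [lambda >= 0] the nearest points are exactly the [v] at which both squares
   vanish.  For [xbar != 0] we seek [b] as a positive multiple of [xbar], of norm
   [w]; the condition on [b] is then the cubic equation
   [2 alpha^2 w^3 + (1 - 2 alpha ybar) w = |xbar|], which is solved by Cardano's
   formula if [Delta >= 0] and by angle trisection if [Delta < 0]. *)
Require Import Defs.
From mathcomp Require Import all_boot all_order all_algebra.
From mathcomp Require Import boolp classical_sets reals exp trigo.
From mathcomp Require Import ring lra.

Import Order.TTheory GRing.Theory Num.Theory.

Local Open Scope classical_set_scope.
Local Open Scope ring_scope.

(** * The Euclidean norm on row vectors *)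

Section EuclideanNorm.
Context {R : realType}.

Lemma enorm_ge0 m (x : 'rV[R]_m) : 0 <= enorm x.
Proof. exact: sqrtr_ge0. Qed.

Lemma sqr_enorm m (x : 'rV[R]_m) : enorm x ^+ 2 = \sum_(i < m) x 0 i ^+ 2.
Proof. by rewrite sqr_sqrtr// sumr_ge0// => i _; rewrite sqr_ge0. Qed.

Lemma enorm0 m : enorm (0 : 'rV[R]_m) = 0.
Proof. by rewrite /enorm big1 ?sqrtr0// => i _; rewrite mxE expr0n. Qed.

Lemma enorm_eq0 m (x : 'rV[R]_m) : (enorm x == 0) = (x == 0).
Proof.
apply/idP/eqP => [|->]; last by rewrite enorm0.
rewrite -sqrf_eq0 sqr_enorm psumr_eq0 => [/allP x0|i _]; last exact: sqr_ge0.
apply/rowP => i; rewrite mxE; apply/eqP.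
by rewrite -sqrf_eq0; apply: x0; rewrite mem_index_enum.
Qed.

Lemma enormZ m (a : R) (x : 'rV[R]_m) : enorm (a *: x) = `|a| * enorm x.
Proof.
rewrite /enorm -sqrtr_sqr -sqrtrM ?sqr_ge0// mulr_sumr.
by congr Num.sqrt; apply: eq_bigr => i _; rewrite mxE exprMn.
Qed.

Lemma enorm_delta m (i : 'I_m) : enorm (delta_mx 0 i : 'rV[R]_m) = 1.
Proof.
rewrite /enorm (bigD1 i)//= big1 => [|j ji]; last first.
  by rewrite mxE (negbTE ji) expr0n.
by rewrite mxE !eqxx expr1n addr0 sqrtr1.
Qed.

(** Stewart's identity for the affine combination [x - a *: b = (1 - a) *: x + a *: (x - b)]. It
    expresses distances to multiples of [b] through norms alone, without an inner product. *)
Lemma sqr_enormBZ {m} (a : R) (x b : 'rV[R]_m) :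
  enorm (x - a *: b) ^+ 2 =
  (1 - a) * enorm x ^+ 2 + a * enorm (x - b) ^+ 2 + (a ^+ 2 - a) * enorm b ^+ 2.
Proof.
rewrite !sqr_enorm !mulr_sumr -!big_split/=; apply: eq_bigr => i _.
rewrite !mxE; ring.
Qed.

Lemma sqr_enorm_ptB n (x a : 'rV[R]_n) (y b : R) :
  enorm (pt x y - pt a b) ^+ 2 = enorm (x - a) ^+ 2 + (y - b) ^+ 2.
Proof.
rewrite !sqr_enorm /pt opp_row_mx add_row_mx big_split_ord/=; congr (_ + _).
  by apply: eq_bigr => i _; rewrite row_mxEl.
by rewrite big_ord1 row_mxEr !mxE.
Qed.

Lemma ler_enorm m (x y : 'rV[R]_m) :
  (enorm x <= enorm y) = (enorm x ^+ 2 <= enorm y ^+ 2).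
Proof. by rewrite ler_pXn2r// nnegrE enorm_ge0. Qed.

End EuclideanNorm.

(** * Nearest points of the paraboloid *)

Section ParaboloidProjection.
Context {R : realType} {n : nat} (alpha : R) (alpha0 : 0 < alpha).
Variables (xbar : 'rV[R]_n) (ybar : R).

Local Notation t := (fun x : 'rV[R]_n => alpha * enorm x ^+ 2).
Local Notation T := [set pt x (t x) | x in [set: 'rV[R]_n]].

Lemma sqr_dist_paraboloid (b v : 'rV[R]_n) (lambda : R) :
  lambda = 2 * alpha ^+ 2 * enorm b ^+ 2 + 1 - 2 * alpha * ybar ->
  xbar = lambda *: b ->
  enorm (pt v (t v) - pt xbar ybar) ^+ 2 =
  enorm (pt b (t b) - pt xbar ybar) ^+ 2 +
  (alpha ^+ 2 * (enorm v ^+ 2 - enorm b ^+ 2) ^+ 2 +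
   lambda * enorm (v - b) ^+ 2).
Proof.
move=> lambdaE ->; rewrite !sqr_enorm_ptB.
rewrite (sqr_enormBZ lambda v) (sqr_enormBZ lambda b) subrr enorm0.
rewrite lambdaE.
move: (enorm v) (enorm b) (enorm (v - b)) => rv rb rvb.
ring.
Qed.

(** The condition on [v - b] keeps its factor [lambda] so that both regimes are covered: for
    [lambda > 0] it forces [v = b], while for [lambda = 0] it is vacuous and a whole sphere
    remains. *)
Lemma proj_paraboloid (b : 'rV[R]_n) (lambda : R) :
  lambda = 2 * alpha ^+ 2 * enorm b ^+ 2 + 1 - 2 * alpha * ybar ->
  0 <= lambda -> xbar = lambda *: b ->
  proj T (pt xbar ybar) =
  [set pt v (t v) | v in
    [set v | enorm v = enorm b /\ lambda * enorm (v - b) ^+ 2 = 0]].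
Proof.
move=> lambdaE lambda0 xbarE.
have dist v := @sqr_dist_paraboloid b v lambda lambdaE xbarE.
have sq1 v : 0 <= alpha ^+ 2 * (enorm v ^+ 2 - enorm b ^+ 2) ^+ 2.
  by rewrite mulr_ge0 ?sqr_ge0.
have sq2 v : 0 <= lambda * enorm (v - b) ^+ 2 by rewrite mulr_ge0 ?sqr_ge0.
apply/seteqP; split => y /= [].
  case=> v _ <- vmin; exists v => //=.
  have: enorm (pt v (t v) - pt xbar ybar) <= enorm (pt b (t b) - pt xbar ybar).
    by apply: vmin; exists b.
  rewrite ler_enorm dist gerDl => le0.
  have /eqP : alpha ^+ 2 * (enorm v ^+ 2 - enorm b ^+ 2) ^+ 2
              + lambda * enorm (v - b) ^+ 2 = 0.
    by apply/eqP; rewrite eq_le le0 addr_ge0.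
  rewrite paddr_eq0// => /andP[]; rewrite mulf_eq0 !sqrf_eq0 (gt_eqF alpha0)/=.
  rewrite subr_eq0 eqrXn2 ?enorm_ge0// => /eqP vb /eqP lvb.
  by split.
move=> v [vb lvb] <-; split; first by exists v.
move=> _ [x _ <-]; rewrite ler_enorm (dist x) (dist v) lvb vb subrr expr0n mulr0.
by rewrite !addr0 lerDl addr_ge0.
Qed.

Lemma proj_paraboloid_cubic (w : R) :
  0 < w -> xbar != 0 ->
  2 * alpha ^+ 2 * w ^+ 3 + (1 - 2 * alpha * ybar) * w = enorm xbar ->
  proj T (pt xbar ybar) =
  [set pt ((w / enorm xbar) *: xbar) (t ((w / enorm xbar) *: xbar))].
Proof.
move=> w0 xbar0 cubic; set b := _ *: xbar.
have rho0 : 0 < enorm xbar by rewrite lt0r enorm_eq0 xbar0 enorm_ge0.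
have bw : enorm b = w.
  by rewrite enormZ ger0_norm ?divr_ge0 ?ltW// divfK// gt_eqF.
(* Dividing the cubic by [w] shows that [enorm xbar / w] is the required [lambda]. *)
have lambda0 : 0 < enorm xbar / w by rewrite divr_gt0.
rewrite (@proj_paraboloid b (enorm xbar / w)) ?ltW//; first last.
- by rewrite scalerA mulf_div [w * _]mulrC mulfV ?scale1r// mulf_neq0 ?gt_eqF.
- rewrite bw -cubic; field; exact: lt0r_neq0.
apply/seteqP; split => y /=.
  move=> [v [_ /eqP]] + <-; rewrite mulf_eq0 gt_eqF//= sqrf_eq0 enorm_eq0.
  by rewrite subr_eq0 => /eqP ->.
by move=> ->; exists b => //=; rewrite subrr enorm0 expr0n mulr0.
Qed.

End ParaboloidProjection.

(** * Real roots of cubic equations *)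

Section Cubic.
Context {R : realType}.

Lemma exprn3_inj : injective (fun x : R => x ^+ 3).
Proof.
move=> x y /= xy; apply/eqP; rewrite -subr_eq0; apply/negPn/negP => xy0.
have xy2 : 0 < (x - y) ^+ 2 by rewrite exprn_even_gt0.
have /eqP : (x - y) * (x ^+ 2 + x * y + y ^+ 2) = 0.
  by transitivity (x ^+ 3 - y ^+ 3); [ring|rewrite xy subrr].
rewrite mulf_eq0 (negbTE xy0)/= => /eqP q0.
(* [4 (x^2 + x y + y^2) = 3 (x + y)^2 + (x - y)^2], which is positive here. *)
have := sqr_ge0 (x + y); nra.
Qed.

(* Cardano's formula for [w^3 + 3 p w = 2 q]. *)
Lemma cardano (p q : R) : 0 <= p ^+ 3 + q ^+ 2 ->
  let s := Num.sqrt (p ^+ 3 + q ^+ 2) in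
  let w := cbrt (q - s) + cbrt (q + s) in
  w ^+ 3 + 3 * p * w = 2 * q.
Proof.
move=> D0 s; set u := cbrt (q - s); set v := cbrt (q + s) => /=.
have u3 : u ^+ 3 = q - s by exact: cbrtK.
have v3 : v ^+ 3 = q + s by exact: cbrtK.
(* Both sides have the same cube, since [(q - s) (q + s) = q^2 - s^2 = - p^3]. *)
have uv : u * v = - p.
  apply: exprn3_inj => /=; rewrite exprMn u3 v3 -subr_sqr sqr_sqrtr//; ring.
transitivity (u ^+ 3 + v ^+ 3 + 3 * (u * v + p) * (u + v)); first ring.
rewrite uv u3 v3; ring.
Qed.

(** A sum of two cubes is the sum of the roots times a nonnegative quadratic form, so a positive sum
    of cubes forces a positive sum of roots. *)
Lemma cbrtD_gt0 (a b : R) : 0 < a + b -> 0 < cbrt a + cbrt b.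
Proof.
rewrite -[X in X + _]cbrtK -[X in _ + X]cbrtK.
set u := cbrt a; set v := cbrt b.
have -> : u ^+ 3 + v ^+ 3 = (u + v) * ((u - v) ^+ 2 + u ^+ 2 + v ^+ 2) / 2.
  by field.
rewrite pmulr_lgt0 ?invr_gt0// => uv.
have := sqr_ge0 (u - v); have := sqr_ge0 u; have := sqr_ge0 v; nra.
Qed.

Lemma cos_triple (x : R) : cos (x *+ 3) = 4 * cos x ^+ 3 - 3 * cos x.
Proof.
rewrite mulrS cosD cos_mulr2n sin_mulr2n.
have := sin2cos2 x => s2.
transitivity (cos x * (cos x ^+ 2 *+ 2 - 1) - 2 * cos x * sin x ^+ 2).
  ring.
rewrite s2; ring.
Qed.

(** Viete's substitution: the scale [2 * m] turns the left side into [2 m^3] times the triple-angle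
    polynomial of the cosine. *)
Lemma trisection (m a : R) : -1 <= a <= 1 ->
  let w := 2 * m * cos (acos a / 3) in
  w ^+ 3 - 3 * m ^+ 2 * w = 2 * m ^+ 3 * a.
Proof.
move=> a1 /=.
have acos3 : cos (acos a / 3 *+ 3) = a.
  by rewrite -mulr_natr divfK ?pnatr_eq0// acosK.
rewrite -[in RHS]acos3 cos_triple; ring.
Qed.

(** The angle lies in [[0, pi/3]], inside the interval where the cosine is positive. *)
Lemma cos_acos3_gt0 (a : R) : -1 <= a <= 1 -> 0 < cos (acos a / 3).
Proof.
move=> a1; have := acos_ge0 a1; have := acos_lepi a1; have := @pi_gt0 R.
move=> pi0 lepi ge0; apply: cos_gt0_pihalf; lra.
Qed.

Lemma powR3half (x : R) : 0 <= x -> x `^ (3 / 2) = Num.sqrt x ^+ 3.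
Proof.
by move=> x0; rewrite mulrC powRrM powR12_sqrt// powR_mulrn ?sqrtr_ge0.
Qed.

End Cubic.

(** * The four cases of the projection formula *)

Theorem theorem5p1 (R : realType) (n : nat) (hn : (1 <= n)%N)
    (alpha : R) (halpha : 0 < alpha) (xbar : 'rV[R]_n) (ybar : R) :
  let t := fun x : 'rV[R]_n => alpha * enorm x ^+ 2 in
  let T := [set pt x (t x) | x in [set: 'rV[R]_n]] in
  let Delta := (1 - 2 * alpha * ybar) ^+ 3 / (216 * alpha ^+ 6)
               + enorm xbar ^+ 2 / (16 * alpha ^+ 4) in
  let theta := acos ((3 * Num.sqrt 6 / 2 * alpha * enorm xbar)
                     / ((2 * alpha * ybar - 1) `^ (3 / 2))) in
  let w1 := cbrt (enorm xbar / (4 * alpha ^+ 2) - Num.sqrt Delta)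
            + cbrt (enorm xbar / (4 * alpha ^+ 2) + Num.sqrt Delta) in
  let w2 := 2 * Num.sqrt ((2 * alpha * ybar - 1) / (6 * alpha ^+ 2))
            * cos (theta / 3) in
  let bw1 := (w1 / enorm xbar) *: xbar in
  let bw2 := (w2 / enorm xbar) *: xbar in
  ~ T (pt xbar ybar) ->
  [/\ xbar = 0 -> 0 <= Delta ->
        proj T (pt xbar ybar) = [set pt 0 0],
      xbar = 0 -> Delta < 0 ->
        proj T (pt xbar ybar) =
          [set pt w (t w) | w in
             [set w : 'rV[R]_n | enorm w =
                Num.sqrt (1 / alpha * ybar - 1 / (2 * alpha ^+ 2))]],
      xbar <> 0 -> 0 <= Delta ->
        proj T (pt xbar ybar) = [set pt bw1 (t bw1)]
    & xbar <> 0 -> Delta < 0 ->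
        proj T (pt xbar ybar) = [set pt bw2 (t bw2)]].
Proof.
move=> t T Delta theta w1 w2 bw1 bw2 _; rewrite /bw1 /bw2.
have alpha_neq0 : alpha != 0 by rewrite gt_eqF.
have alpha2_gt0 : 0 < alpha ^+ 2 by rewrite exprn_gt0.
pose rho := enorm xbar; pose k := 2 * alpha * ybar - 1.
have rho_ge0 : 0 <= rho by exact: enorm_ge0.
have DeltaE : Delta = (rho ^+ 2 * (27 / 2 * alpha ^+ 2) - k ^+ 3)
                      / (216 * alpha ^+ 6).
  by rewrite /Delta /rho /k; field.
have den_gt0 : 0 < 216 * alpha ^+ 6 by rewrite mulr_gt0 ?exprn_gt0.
have k_gt0 : Delta < 0 -> 0 < k.
  rewrite DeltaE pmulr_llt0 ?invr_gt0// subr_lt0 => kD.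
  have : 0 < k ^+ 3.
    by apply: le_lt_trans kD; rewrite mulr_ge0 ?sqr_ge0// mulr_ge0 ?ltW//; lra.
  by rewrite exprn_odd_gt0.
split => [xbar0 Delta_ge0|xbar0 /k_gt0 k0
   |/eqP xbar0 Delta_ge0|/eqP xbar0 Delta_lt0].
- have k_le0 : k <= 0.
    move: Delta_ge0; rewrite DeltaE /rho xbar0 enorm0 expr0n mul0r sub0r.
    by rewrite pmulr_lge0 ?invr_gt0// oppr_ge0 exprn_odd_le0.
  (* The vertex [b = 0] gives [lambda = - k]. *)
  rewrite (@proj_paraboloid _ _ _ halpha _ _ 0 (- k)) ?scaler0 ?oppr_ge0//.
    apply/seteqP; split => y /=.
      move=> [v [/eqP]] + _ <-; rewrite enorm0 enorm_eq0 => /eqP ->.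
      by rewrite enorm0 expr0n mulr0.
    move=> ->; exists 0; last by rewrite enorm0 expr0n mulr0.
    by rewrite /= subrr enorm0 expr0n mulr0.
  by rewrite enorm0 /k; ring.
- have radE : 1 / alpha * ybar - 1 / (2 * alpha ^+ 2) = k / (2 * alpha ^+ 2).
    by rewrite /k; field.
  rewrite radE; set w := Num.sqrt _.
  have w2E : w ^+ 2 = k / (2 * alpha ^+ 2).
    by rewrite sqr_sqrtr// divr_ge0 ?mulr_ge0 ?ltW.
  (* For [lambda = 0] any vector of norm [w] serves as [b]; a coordinate vector to scale exists
     because [1 <= n]. *)
  pose b : 'rV[R]_n := w *: delta_mx 0 (Ordinal hn).
  have bw : enorm b = w by rewrite enormZ enorm_delta mulr1 ger0_norm ?sqrtr_ge0.
  rewrite (@proj_paraboloid _ _ _ halpha _ _ b 0) ?scale0r//.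
    congr image; apply/seteqP; split => v /=; rewrite bw; first by case.
    by rewrite mul0r.
  by rewrite bw w2E /k; field.
- apply: proj_paraboloid_cubic => //.
    (* The square roots cancel in the sum of the two radicands. *)
    apply: cbrtD_gt0; rewrite addrACA addNr addr0 -/rho.
    have rho_gt0 : 0 < rho by rewrite lt0r enorm_eq0 xbar0.
    by rewrite addr_gt0// divr_gt0 ?mulr_gt0.
  (* Division by [2 alpha^2] brings the cubic to Cardano's form with these [p] and [q], and [Delta]
     is [p^3 + q^2]. *)
  have DE : Delta = (- k / (6 * alpha ^+ 2)) ^+ 3 + (rho / (4 * alpha ^+ 2)) ^+ 2.
    by rewrite DeltaE; field.
  have := @cardano R (- k / (6 * alpha ^+ 2)) (rho / (4 * alpha ^+ 2)).
  rewrite -DE => /(_ Delta_ge0) /=; rewrite -/rho -/w1 => cubic.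
  transitivity (2 * alpha ^+ 2 *
      (w1 ^+ 3 + 3 * (- k / (6 * alpha ^+ 2)) * w1)); last by rewrite cubic; field.
  by rewrite /k; field.
have k0 := k_gt0 Delta_lt0.
(* Now [p = - m^2], so the cubic reads [w^3 - 3 m^2 w = rho / (2 alpha^2)]. *)
pose m := Num.sqrt (k / (6 * alpha ^+ 2)).
have m2E : m ^+ 2 = k / (6 * alpha ^+ 2).
  by rewrite sqr_sqrtr// divr_ge0 ?mulr_ge0 ?ltW.
have m_gt0 : 0 < m by rewrite sqrtr_gt0 divr_gt0 ?mulr_gt0.
have sqrt6_gt0 : 0 < Num.sqrt 6 :> R by rewrite sqrtr_gt0.
have sqrt6E : Num.sqrt 6 ^+ 2 = 6 :> R by rewrite sqr_sqrtr.
have sqrtkE : Num.sqrt k = Num.sqrt 6 * alpha * m.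
  rewrite -[RHS]ger0_norm ?mulr_ge0 ?ltW// -sqrtr_sqr; congr Num.sqrt.
  by rewrite !exprMn m2E sqrt6E; field.
(* Chosen so that [2 m^3 a = rho / (2 alpha^2)], the right side of the cubic. *)
pose a := rho / (4 * alpha ^+ 2 * m ^+ 3).
have m_neq0 : m != 0 by rewrite gt_eqF.
have thetaE : theta = acos a.
  rewrite /theta -/k -/rho powR3half ?ltW// sqrtkE; congr acos.
  rewrite !exprMn [Num.sqrt 6 ^+ 3]exprS sqrt6E /a.
  by field; rewrite alpha_neq0 m_neq0 gt_eqF.
have a_ge0 : 0 <= a by rewrite divr_ge0// !mulr_ge0 ?exprn_ge0 ?ltW.
have a_le1 : a <= 1.
  rewrite -(@expr_le1 _ 2)//.
  (* With [a = q / m^3] and [Delta = q^2 - m^6], negativity of [Delta] bounds [a]. *)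
  have -> : a ^+ 2 = 1 + Delta / (m ^+ 2) ^+ 3.
    rewrite DeltaE (_ : k = 6 * alpha ^+ 2 * m ^+ 2) /a.
      by field; exact/andP.
    by rewrite m2E; field.
  by rewrite gerDl pmulr_lle0 ?ltW// invr_gt0 !exprn_gt0.
have a1 : -1 <= a <= 1 by rewrite a_le1 andbT; lra.
have w2E : w2 = 2 * m * cos (acos a / 3) by rewrite /w2 thetaE.
apply: proj_paraboloid_cubic => //.
  by rewrite w2E !mulr_gt0// cos_acos3_gt0.
have := @trisection R m a a1 => /=; rewrite -w2E => cubic.
transitivity (2 * alpha ^+ 2 * (w2 ^+ 3 - 3 * m ^+ 2 * w2)).
  by rewrite m2E /k; field.
by rewrite cubic /a -/rho; field; exact/andP.
Qed.
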